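(* Let $\theta\geq\sigma>0$, $n\geq 1$, $M\ge 1$, $\Upsilon>0$. Then $$\epsilon_{\mathrm{m}}^{\star}(n,M,\Upsilon)\;\geq\;\alpha_{1/M}\bigl(\varphi^n_{\sqrt{\Upsilon},\sigma},\varphi^n_{0,\theta}\bigr).$$
   Context: $\varphi_{\mu,\sigma}(y)=\frac{1}{\sqrt{2\pi}\sigma}e^{-(y-\mu)^2/(2\sigma^2)}$ and $\varphi^n_{\mu,\sigma}$ denotes the distribution on $\mathbb{R}^n$ of $n$ i.i.d. $\mathcal{N}(\mu,\sigma^2)$ coordinates. For distributions $A,B$ on a common space $\mathcal{Z}$ and $\beta\in[0,1]$, $\alpha_\beta(A,B)=\inf\{1-\mathbb{E}_A[T(Z)]:\ T:\mathcal{Z}\to[0,1]\text{ measurable},\ \mathbb{E}_B[T(Z)]\le\beta\}$. AWGN channel with noise variance $\sigma^2$: input $\mathbf{x}\in\mathbb{R}^n$, output density $\prod_i\varphi_{x_i,\sigma}(y_i)$. For a codebook $\mathcal{C}=\{\mathbf{c}_1,\dots,\mathbf{c}_M\}\subset\mathbb{R}^n$ with uniformly distributed message and maximum-likelihood decoding, $P_e(\mathcal{C})$ is the average error probability. $\epsilon_{\mathrm{m}}^{\star}(n,M,\Upsilon)=\inf\{P_e(\mathcal{C}):\|\mathbf{c}_i\|^2\le n\Upsilon\ \forall i\}$. *)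

(* Defs.v *)
From HB Require Import structures.
From mathcomp Require Import all_boot all_order all_algebra.
From mathcomp Require Import all_classical all_reals all_analysis.
Set Implicit Arguments. Unset Strict Implicit. Unset Printing Implicit Defensive.
Import Order.TTheory GRing.Theory Num.Theory.
Local Open Scope classical_set_scope.
Local Open Scope ring_scope.

Section awgn.
Variable R : realType.

(* Lebesgue integral over R^n (= n.-tuple R, with its product sigma-algebra)
   of a nonnegative function, written as an iterated Lebesgue integral
   (equal to the integral w.r.t. n-dimensional Lebesgue measure by Tonelli). *)
Fixpoint lint_n (n : nat) : (n.-tuple R -> \bar R) -> \bar R :=
  match n return (n.-tuple R -> \bar R) -> \bar R with
  | 0 => fun g => g [tuple]
  | n'.+1 => fun g =>
      (\int[@lebesgue_measure R]_x lint_n (fun t : n'.-tuple R => g (cons_tuple x t)))%E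
  end.

Definition dexp n (p f : n.-tuple R -> R) : \bar R :=
  lint_n (fun y => (f y * p y)%:E).

Definition iid_gauss_dens n (mu sigma : R) (y : n.-tuple R) : R :=
  \prod_(i < n) normal_pdf mu sigma (tnth y i).

Definition awgn_dens n (sigma : R) (x y : n.-tuple R) : R :=
  \prod_(i < n) normal_pdf (tnth x i) sigma (tnth y i).

Definition alpha_beta n (beta : R) (pA pB : n.-tuple R -> R) : \bar R :=
  ereal_inf [set (1%:E - dexp pA T)%E | T in
    [set T : n.-tuple R -> R |
       [/\ measurable_fun setT T, (forall y, 0 <= T y <= 1) &
           (dexp pB T <= beta%:E)%E]]].

(* ML decoding (ties broken towards the smallest index) decodes y to j *)
Definition ml_decodes n M (sigma : R) (c : 'I_M -> n.-tuple R)
    (j : 'I_M) (y : n.-tuple R) : bool :=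
  [forall i : 'I_M,
     if (i < j)%N then awgn_dens sigma (c i) y < awgn_dens sigma (c j) y
     else awgn_dens sigma (c i) y <= awgn_dens sigma (c j) y].

Definition Pe n M (sigma : R) (c : 'I_M -> n.-tuple R) : \bar R :=
  ((M%:R)^-1)%:E *
  \sum_(j < M) dexp (awgn_dens sigma (c j))
                    (fun y => if ml_decodes sigma c j y then 0%R else 1%R).

Definition eps_star_m (sigma : R) (n M : nat) (Ups : R) : \bar R :=
  ereal_inf [set Pe sigma c | c in
    [set c : 'I_M -> n.-tuple R |
       forall i, \sum_(k < n) (tnth (c i) k) ^+ 2 <= n%:R * Ups]].

End awgn.

(* Main.v *)
Require Import Defs.
From HB Require Import structures.
From mathcomp Require Import all_boot all_order all_algebra.
From mathcomp Require Import all_classical all_reals all_analysis.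
From mathcomp Require Import measurable_realfun ring lra.
Import Order.TTheory GRing.Theory Num.Theory.
Local Open Scope classical_set_scope.
Local Open Scope ring_scope.

(** Meta-converse with output distribution [q = N(0, theta^2)^n].  By the
    Neyman-Pearson lemma there are [lam >= 0] and a test [T] of level [1/M] with
    [E_p T = E_lam(p) + lam / M], where [p = N(sqrt Ups, sigma^2)^n] and
    [E_lam(w) = \int max 0 (w - lam q)].  For each codeword with output density
    [w_j] and decoding region [D_j], [w_j(D_j) <= E_lam(w_j) + lam q(D_j)]; since
    the [D_j] are disjoint, averaging over [j] gives the bound as soon as
    [E_lam(w_j) <= E_lam(p)], i.e. as soon as the hockey-stick divergence
    [E_lam] is nondecreasing in the norm of the mean.

    In dimension one, after translating by the increment [d] of the mean, this
    compares [\int max 0 (p - lam q)] with [\int max 0 (p - lam q(. + d))]; the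
    integrands become pointwise comparable once [y] is paired with [- d - y],
    because [sigma <= theta] makes the likelihood ratio larger at the greater of
    the two points.  In higher dimension, rotation invariance in two coordinates
    (a rotation being a product of three shears, it only needs Tonelli and
    translation invariance) moves the whole mean to a single coordinate. *)

(** * Iterated Lebesgue integrals of nonnegative functions over R^n *)

Section lint_n_theory.
Local Open Scope ereal_scope.
Context {R : realType}.
Implicit Types n : nat.

Lemma lint_n_ge0 n (f : n.-tuple R -> \bar R) :
  (forall y, 0 <= f y) -> 0 <= lint_n f.
Proof.
elim: n f => [|n IH] f f0 /=; first exact: f0.
by apply: integral_ge0 => x _; exact: IH.
Qed.

(** The parameter space is arbitrary so that the induction can move the coordinate being integrated
    into it: at the successor step the hypothesis is applied over [T * R], and Tonelli integrates
    the added factor out. *)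
Lemma measurable_lint_n n {d : measure_display} {T : measurableType d}
    (g : T * n.-tuple R -> \bar R) :
  measurable_fun setT g -> (forall z, 0 <= g z) ->
  measurable_fun setT (fun t => lint_n (fun y => g (t, y))).
Proof.
elim: n d T g => [|n IH] d T g mg g0 /=.
  exact: (measurable_fun_pair1 (nil_tuple R) mg).
pose h (z : T * R) := lint_n (fun u : n.-tuple R => g (z.1, cons_tuple z.2 u)).
apply: (measurable_fun_fubini_tonelli_F (m2 := @lebesgue_measure R) h).
  apply: (IH _ _ (fun z => g (z.1.1, cons_tuple z.1.2 z.2))) => //.
  apply: (measurableT_comp mg) => /=; apply: measurable_fun_pair => /=.
    exact: (measurableT_comp measurable_fst measurable_fst).
  apply: (@measurable_cons _ _ _ _ (fun z => z.1.2) _ snd).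
    exact: (measurableT_comp measurable_snd measurable_fst).
  exact: measurable_snd.
by move=> z; apply: lint_n_ge0.
Qed.

Lemma measurable_cons_pair n :
  measurable_fun setT (fun z : R * n.-tuple R => cons_tuple z.1 z.2).
Proof.
exact: (@measurable_cons _ _ _ _ fst _ snd measurable_fst measurable_snd).
Qed.

Lemma measurable_fun_cons n (x : R) d (U : measurableType d)
    (f : n.+1.-tuple R -> U) :
  measurable_fun setT f ->
  measurable_fun setT (fun y : n.-tuple R => f (cons_tuple x y)).
Proof.
move=> mf; apply: (@measurable_fun_pair2 _ _ _ _ _ _
  (fun z : R * n.-tuple R => f (cons_tuple z.1 z.2)) x).
exact: (measurableT_comp mf (@measurable_cons_pair n)).
Qed.

Lemma measurable_lint_n_cons n (f : n.+1.-tuple R -> \bar R) :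
  measurable_fun setT f -> (forall y, 0 <= f y) ->
  measurable_fun setT (fun x : R => lint_n (fun y => f (cons_tuple x y))).
Proof.
move=> mf f0.
apply: (@measurable_lint_n _ _ _ (fun z => f (cons_tuple z.1 z.2))) => //.
exact: (measurableT_comp mf (@measurable_cons_pair n)).
Qed.

Lemma le_lint_n n (f g : n.-tuple R -> \bar R) :
  measurable_fun setT f -> measurable_fun setT g ->
  (forall y, 0 <= f y) -> (forall y, f y <= g y) -> lint_n f <= lint_n g.
Proof.
elim: n f g => [|n IH] f g mf mg f0 fg /=; first exact: fg.
have g0 y : 0 <= g y by apply: le_trans (fg y).
apply: ge0_le_integral => //.
- by move=> x _; exact: lint_n_ge0.
- exact: measurable_lint_n_cons.
- exact: measurable_lint_n_cons.
- by move=> x _; apply: IH => //; exact: measurable_fun_cons.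
Qed.

Lemma eq_lint_n n (f g : n.-tuple R -> \bar R) : f =1 g -> lint_n f = lint_n g.
Proof. by move=> /funext ->. Qed.

Lemma lint_nD n (f g : n.-tuple R -> \bar R) :
  measurable_fun setT f -> measurable_fun setT g ->
  (forall y, 0 <= f y) -> (forall y, 0 <= g y) ->
  lint_n (fun y => f y + g y) = lint_n f + lint_n g.
Proof.
elim: n f g => [//|n IH] f g mf mg f0 g0 /=.
rewrite -ge0_integralD//.
- by apply: eq_integral => x _; rewrite IH//; exact: measurable_fun_cons.
- by move=> x _; exact: lint_n_ge0.
- exact: measurable_lint_n_cons.
- by move=> x _; exact: lint_n_ge0.
- exact: measurable_lint_n_cons.
Qed.

Lemma lint_nZl n (k : R) (f : n.-tuple R -> \bar R) : (0 <= k)%R ->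
  measurable_fun setT f -> (forall y, 0 <= f y) ->
  lint_n (fun y => k%:E * f y) = k%:E * lint_n f.
Proof.
move=> k0; elim: n f => [//|n IH] f mf f0 /=.
rewrite -ge0_integralZl//.
- by apply: eq_integral => x _; rewrite IH//; exact: measurable_fun_cons.
- exact: measurable_lint_n_cons.
- by move=> x _; exact: lint_n_ge0.
Qed.

Lemma lint_n0 n : lint_n (fun _ : n.-tuple R => 0) = 0.
Proof. by elim: n => [//|n IH] /=; rewrite IH integral0. Qed.

Lemma lint_n_sum n (I : Type) (r : seq I) (f : I -> n.-tuple R -> \bar R) :
  (forall i, measurable_fun setT (f i)) -> (forall i y, 0 <= f i y) ->
  lint_n (fun y => \sum_(i <- r) f i y) = \sum_(i <- r) lint_n (f i).
Proof.
move=> mf f0; elim: r => [|i r IH].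
  by rewrite big_nil -[RHS](lint_n0 n); apply: eq_lint_n => y; rewrite big_nil.
rewrite big_cons -IH -lint_nD//.
- by apply: eq_lint_n => y; rewrite big_cons.
- exact: emeasurable_sum.
- by move=> y; exact: sume_ge0.
Qed.

(** One-dimensional monotone convergence is applied at each level; the inner integrals are again
    nondecreasing in [k] by [le_lint_n]. *)
Lemma lint_n_monotone_convergence n (f : nat -> n.-tuple R -> \bar R) :
  (forall k, measurable_fun setT (f k)) -> (forall k y, 0 <= f k y) ->
  (forall y, {homo f ^~ y : k l / (k <= l)%N >-> k <= l}) ->
  lint_n (fun y => limn (f ^~ y)) = limn (fun k => lint_n (f k)).
Proof.
elim: n f => [//|n IH] f mf f0 ndf /=.
rewrite -monotone_convergence//.
- apply: eq_integral => x _; rewrite (IH (fun k y => f k (cons_tuple x y)))//.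
  by move=> k; exact: measurable_fun_cons.
- by move=> k; exact: measurable_lint_n_cons.
- by move=> k x _; exact: lint_n_ge0.
- move=> x _ k l kl; apply: le_lint_n => //.
  + exact: measurable_fun_cons.
  + exact: measurable_fun_cons.
  + by move=> y; exact: ndf.
Qed.

End lint_n_theory.

(** * Translations, reflections, shears and rotations preserve Lebesgue integrals *)

Section lebesgue_invariance.
Local Open Scope ereal_scope.
Context {R : realType}.
Local Notation mu := (@lebesgue_measure R).

(** By uniqueness of Lebesgue measure it suffices to compare the two measures on half-open
    intervals, where a shift preserves length. *)
Lemma lebesgue_measure_shift (c : R) (A : set R) : measurable A ->
  pushforward mu ((fun x => x + c)%R : _ -> measurableTypeR R) A = mu A.
Proof.
move=> mA; apply/esym/lebesgue_measure_unique => //=.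
  exact: (@measurable_funD _ _ R _ id (cst c)).
move=> mf _ [[a b]] _ <-; rewrite /pushforward/=.
rewrite (_ : _ @^-1` _ = `](a - c)%R, (b - c)%R]%classic).
  rewrite !lebesgue_measure_itv/= !lte_fin ltrD2r; case: ifP => // _.
  by rewrite -!EFinD; congr EFin; ring.
by apply/seteqP; split=> x /=; rewrite !in_itv/= ltrBlDr lerBrDr.
Qed.

Lemma ge0_integral_shift (c : R) (f : R -> \bar R) :
  measurable_fun setT f -> (forall x, 0 <= f x) ->
  \int[mu]_x f (x + c)%R = \int[mu]_x f x.
Proof.
move=> mf f0.
have -> : \int[mu]_x f (x + c)%R =
    \int[pushforward mu ((fun x => x + c)%R : _ -> measurableTypeR R)]_x f x.
  by rewrite ge0_integral_pushforward//; exact: (@measurable_funD _ _ R _ id (cst c)).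
apply: eq_measure_integral => //=; first exact: (@measurable_funD _ _ R _ id (cst c)).
by move=> ? A mA AS; exact: lebesgue_measure_shift.
Qed.

Lemma ge0_integral_opp (f : R -> \bar R) :
  measurable_fun setT f -> (forall x, 0 <= f x) ->
  \int[mu]_x f (- x)%R = \int[mu]_x f x.
Proof.
move=> mf f0.
have -> : \int[mu]_x f (- x)%R =
    \int[pushforward mu (-%R : _ -> measurableTypeR R)]_x f x.
  by rewrite ge0_integral_pushforward//.
by apply: eq_measure_integral => //= A mA AS; exact: lebesgue_measureN.
Qed.

Lemma ge0_integral_reflect (c : R) (f : R -> \bar R) :
  measurable_fun setT f -> (forall x, 0 <= f x) ->
  \int[mu]_x f (c - x)%R = \int[mu]_x f x.
Proof.
move=> mf f0; rewrite -(ge0_integral_shift c f)//.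
rewrite -(ge0_integral_opp (fun x => f (x + c)%R))//.
  by apply: eq_integral => x _; rewrite addrC.
apply: (measurableT_comp mf); exact: measurable_funD.
Qed.

Definition int2 (K : R * R -> \bar R) := \int[mu]_x \int[mu]_y K (x, y).

Lemma int2_shear1 (t : R) (K : R * R -> \bar R) :
  measurable_fun setT K -> (forall z, 0 <= K z) ->
  int2 (fun z => K (z.1 + t * z.2, z.2)%R) = int2 K.
Proof.
move=> mK K0; rewrite /int2 /=.
(* Tonelli makes the sheared coordinate the inner variable; with the other one fixed, the shear is a
   translation. *)
rewrite (fubini_tonelli (m1 := mu) (m2 := mu) (fun z => K (z.1 + t * z.2, z.2)%R))//=.
  rewrite (fubini_tonelli (m1 := mu) (m2 := mu) K)//; apply: eq_integral => y _.
  rewrite (ge0_integral_shift _ (fun x => K (x, y)))//.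
  exact: measurable_fun_pair1.
apply: (measurableT_comp mK); apply: measurable_fun_pair => //=.
by apply: measurable_funD => //; apply: measurable_funM.
Qed.

Lemma int2_shear2 (t : R) (K : R * R -> \bar R) :
  measurable_fun setT K -> (forall z, 0 <= K z) ->
  int2 (fun z => K (z.1, z.2 + t * z.1)%R) = int2 K.
Proof.
move=> mK K0; apply: eq_integral => x _ /=.
rewrite (ge0_integral_shift _ (fun y => K (x, y)))//.
exact: measurable_fun_pair2.
Qed.

(* A rotation other than the half-turn is a product of three shears. *)
Lemma int2_rotation (c s : R) (K : R * R -> \bar R) :
  (c ^+ 2 + s ^+ 2 = 1)%R -> (c != -1)%R ->
  measurable_fun setT K -> (forall z, 0 <= K z) ->
  int2 (fun z => K (c * z.1 - s * z.2, s * z.1 + c * z.2)%R) = int2 K.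
Proof.
move=> cs c1 mK K0.
have c10 : (1 + c != 0)%R by rewrite addrC addr_eq0.
(* For [c] and [s] the cosine and sine of an angle, [t] is the tangent of half that angle. The
   shears have coefficients [- t], [s], [- t]. *)
pose t := (s / (1 + c))%R.
pose K1 z := K (z.1 + (- t) * z.2, z.2)%R.
pose K2 z := K1 (z.1, z.2 + s * z.1)%R.
have K10 z : 0 <= K1 z by exact: K0.
have K20 z : 0 <= K2 z by exact: K0.
have mK1 : measurable_fun setT K1.
  apply: (measurableT_comp mK); apply: measurable_fun_pair => //=.
  by apply: measurable_funD => //; apply: measurable_funM.
have mK2 : measurable_fun setT K2.
  apply: (measurableT_comp mK1); apply: measurable_fun_pair => //=.
  by apply: measurable_funD => //; apply: measurable_funM.
rewrite -(int2_shear1 (- t) K)// -/K1 -(int2_shear2 s K1)// -/K2.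
rewrite -(int2_shear1 (- t) K2)//.
congr int2; apply/funext => -[x y]; rewrite /K2 /K1 /=.
have st : (s * t = 1 - c)%R.
  by rewrite /t mulrA -expr2 (_ : s ^+ 2 = (1 - c) * (1 + c))%R ?mulfK//; lra.
have tc : (t * (1 + c) = s)%R by rewrite /t divfK.
congr K; congr pair.
  transitivity (x - (s * t) * x - (t + t - t * (s * t)) * y)%R; last by ring.
  by rewrite st -tc; ring.
transitivity (s * x + (1 - s * t) * y)%R; last by ring.
by rewrite st; ring.
Qed.

End lebesgue_invariance.

(** * Monotonicity of the hockey-stick divergence in dimension one *)

Section hockey_stick_1d.
Context {R : realType}.
Local Notation mu := (@lebesgue_measure R).
Implicit Types (sigma theta A B a d x y : R).

Lemma normal_pdf_expR m s y : s != 0 ->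
  normal_pdf m s y = normal_peak s * expR (- ((y - m) ^+ 2 / (s ^+ 2 *+ 2))).
Proof. by move=> s0; rewrite normal_pdfE// /normal_fun mulNr. Qed.

Lemma normal_pdf_opp m s y : s != 0 -> normal_pdf (- m) s (- y) = normal_pdf m s y.
Proof.
by move=> s0; rewrite !normal_pdf_expR// -opprD sqrrN.
Qed.

Lemma normal_pdf0_opp s y : s != 0 -> normal_pdf 0 s (- y) = normal_pdf 0 s y.
Proof. by move=> s0; rewrite -[X in normal_pdf X s (- y)]oppr0 normal_pdf_opp. Qed.

Lemma normal_pdfD m s y d : s != 0 -> normal_pdf (m + d) s (y + d) = normal_pdf m s y.
Proof.
by move=> s0; rewrite !normal_pdf_expR// (_ : y + d - (m + d) = y - m)//; ring.
Qed.

Definition gauss_excess sigma theta A B a y : R :=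
  Num.max 0 (A * normal_pdf a sigma y - B * normal_pdf 0 theta y).

Lemma gauss_excess_ge0 sigma theta A B a y : 0 <= gauss_excess sigma theta A B a y.
Proof. by rewrite le_max lexx. Qed.

Lemma measurable_gauss_excess sigma theta A B a :
  measurable_fun setT (gauss_excess sigma theta A B a).
Proof.
apply: measurable_maxr => //; apply: measurable_funB.
  by apply: measurable_funM => //; exact: measurable_normal_pdf.
by apply: measurable_funM => //; exact: measurable_normal_pdf.
Qed.

(** If [P' <= Q'], the second term on the left vanishes and replacing [Q] by the smaller [Q'] only
    raises the first. Otherwise the ratio hypothesis forces [Q <= P], so both terms on the left
    equal their arguments, whose sum is also the sum of the arguments on the right. *)
Lemma max0_sub_exchange (P P' Q Q' : R) :
  0 <= P -> 0 <= Q' -> Q' <= Q -> P' * Q <= P * Q' ->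
  Num.max 0 (P - Q) + Num.max 0 (P' - Q') <=
  Num.max 0 (P - Q') + Num.max 0 (P' - Q).
Proof.
move=> P0 Q'0 Q'Q PQ.
have m0 (u : R) : 0 <= Num.max 0 u by rewrite le_max lexx.
have mx (u : R) : u <= Num.max 0 u by rewrite le_max lexx orbT.
have [P'Q'|P'Q'] := leP P' Q'.
  rewrite (max_l (_ : P' - Q' <= 0)) ?subr_le0// addr0.
  apply: ler_wpDr => //; rewrite ge_max m0/=.
  by apply: le_trans (mx (P - Q')); rewrite lerD2l lerN2.
have QP : Q <= P.
  have [Q'p|Q'n] := ltP 0 Q'.
    rewrite -(ler_pM2r Q'p); apply: le_trans PQ; rewrite mulrC.
    by apply: ler_wpM2r (ltW P'Q'); exact: le_trans Q'Q.
  have Q'e : Q' = 0 by apply/eqP; rewrite eq_le Q'n.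
  move: P'Q' PQ; rewrite Q'e mulr0 => P'p; rewrite pmulr_rle0// => Qn.
  exact: le_trans P0.
rewrite (max_r (_ : 0 <= P - Q)) ?subr_ge0//.
rewrite (max_r (_ : 0 <= P' - Q')) ?subr_ge0 ?(ltW P'Q')//.
by apply: le_trans (lerD (mx (P - Q')) (mx (P' - Q))); lra.
Qed.

(** The difference of the two exponents factors as [(2 * y + d) * (d * (u - v) + 2 * a * u)], where
    [u] and [v] are the inverses of twice the variances. The hypothesis [sigma <= theta] gives
    [v <= u], hence both factors are nonnegative. *)
Lemma normal_pdf_ratio sigma theta a d y : 0 < sigma -> sigma <= theta ->
  0 <= a -> 0 <= d -> - d <= 2 * y ->
  normal_pdf a sigma (- d - y) * normal_pdf 0 theta y <=
  normal_pdf a sigma y * normal_pdf 0 theta (- d - y).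
Proof.
move=> s0 st a0 d0 dy; have t0 : 0 < theta by exact: lt_le_trans st.
rewrite !normal_pdf_expR ?gt_eqF// [leLHS]mulrACA [leRHS]mulrACA -!expRD.
rewrite ler_wpM2l ?mulr_ge0 ?normal_peak_ge0// ler_expR !subr0 -[leLHS]opprD -[leRHS]opprD lerN2.
set u := (sigma ^+ 2 *+ 2)^-1; set v := (theta ^+ 2 *+ 2)^-1.
have v0 : 0 <= v by rewrite invr_ge0 mulrn_wge0// sqr_ge0.
have vu : v <= u.
  rewrite lef_pV2 ?posrE ?pmulrn_rgt0 ?exprn_gt0//.
  by rewrite lerMn2r/=; rewrite ler_sqr ?nnegrE ?(ltW s0) ?(ltW t0).
rewrite -subr_ge0.
have -> : (- d - y - a) ^+ 2 * u + y ^+ 2 * v -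
  ((y - a) ^+ 2 * u + (- d - y) ^+ 2 * v) =
  (2 * y + d) * (d * (u - v) + 2 * a * u) by ring.
apply: mulr_ge0; first by lra.
by rewrite addr_ge0 ?mulr_ge0 ?subr_ge0//; exact: le_trans vu.
Qed.

(* Pairing [y] with its mirror image [- d - y] makes the integrands comparable. *)
Lemma gauss_excess_pair sigma theta A B a d y : 0 < sigma -> sigma <= theta ->
  0 <= A -> 0 <= B -> 0 <= a -> 0 <= d ->
  gauss_excess sigma theta A B a y + gauss_excess sigma theta A B a (- d - y) <=
  gauss_excess sigma theta A B (a + d) (y + d) +
  gauss_excess sigma theta A B (a + d) (- d - y + d).
Proof.
move=> s0 st A0 B0 a0 d0.
pose f z := gauss_excess sigma theta A B a z.
pose g z := gauss_excess sigma theta A B (a + d) (z + d).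
rewrite -/(f y) -/(f (- d - y)) -/(g y) -/(g (- d - y)).
have t0 : 0 < theta by exact: lt_le_trans st.
have sn0 : sigma != 0 by rewrite gt_eqF.
have tn0 : theta != 0 by rewrite gt_eqF.
(* Both sides are invariant under exchanging [y] and [- d - y], so [y] may be taken as the greater
   of the two. *)
wlog dy : y / - d <= 2 * y.
  move=> H; have [|dy] := leP (- d) (2 * y); first exact: H.
  have := H (- d - y); rewrite !opprD !opprK addKr ![_ + f y]addrC ![_ + g y]addrC.
  by apply; lra.
(* The centred Gaussian is even, so its value translated by [d] at a point is its value at the
   mirror image. The translation thus merely swaps the two subtracted terms, which is the exchange
   of [max0_sub_exchange]. *)
have q_sym z : normal_pdf 0 theta (z + d) = normal_pdf 0 theta (- d - z).
  by rewrite -[in RHS]opprD addrC normal_pdf0_opp.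
rewrite /f /g /gauss_excess !normal_pdfD// !q_sym (_ : - d - (- d - y) = y); last by ring.
apply: max0_sub_exchange.
- by rewrite mulr_ge0 ?normal_pdf_ge0.
- by rewrite mulr_ge0 ?normal_pdf_ge0.
- rewrite ler_wpM2l// !normal_pdf_expR// ler_wpM2l ?normal_peak_ge0//.
  rewrite ler_expR lerN2 !subr0 ler_wpM2r ?invr_ge0 ?mulrn_wge0 ?sqr_ge0//.
  by nra.
- rewrite [leLHS]mulrACA [leRHS]mulrACA ler_wpM2l ?mulr_ge0//.
  exact: normal_pdf_ratio.
Qed.

Lemma integral_gauss_excess_opp sigma theta A B a : sigma != 0 -> theta != 0 ->
  (\int[mu]_y (gauss_excess sigma theta A B (- a) y)%:E =
   \int[mu]_y (gauss_excess sigma theta A B a y)%:E)%E.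
Proof.
move=> s0 t0.
rewrite -(ge0_integral_opp (fun y => (gauss_excess sigma theta A B (- a) y)%:E)).
- apply: eq_integral => y _.
  by rewrite /gauss_excess normal_pdf_opp// normal_pdf0_opp.
- apply/measurable_EFinP; exact: measurable_gauss_excess.
- by move=> y; rewrite lee_fin gauss_excess_ge0.
Qed.

Lemma integral_gauss_excess_norm sigma theta A B a : sigma != 0 -> theta != 0 ->
  (\int[mu]_y (gauss_excess sigma theta A B `|a| y)%:E =
   \int[mu]_y (gauss_excess sigma theta A B a y)%:E)%E.
Proof.
by move=> s0 t0; case: ler0P => // _; rewrite integral_gauss_excess_opp.
Qed.

Lemma le_integral_gauss_excess sigma theta A B a b : 0 < sigma -> sigma <= theta ->
  0 <= A -> 0 <= B -> `|a| <= `|b| ->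
  (\int[mu]_y (gauss_excess sigma theta A B a y)%:E <=
   \int[mu]_y (gauss_excess sigma theta A B b y)%:E)%E.
Proof.
move=> s0 st A0 B0 ab; have t0 : 0 < theta by exact: lt_le_trans st.
have sn0 : sigma != 0 by rewrite gt_eqF.
have tn0 : theta != 0 by rewrite gt_eqF.
(* Reflection removes the signs of the means; the larger absolute value is then the smaller one plus
   some [d >= 0]. *)
rewrite -[leLHS](integral_gauss_excess_norm sigma theta A B a sn0 tn0).
rewrite -[leRHS](integral_gauss_excess_norm sigma theta A B b sn0 tn0).
set a' := `|a| in ab *; have a0 : 0 <= a' by exact: normr_ge0.
have [d d0 ->] : exists2 d, 0 <= d & `|b| = a' + d.
  by exists (`|b| - a'); [rewrite subr_ge0|rewrite addrC subrK].
pose f y := (gauss_excess sigma theta A B a' y)%:E.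
pose g y := (gauss_excess sigma theta A B (a' + d) (y + d))%:E.
have mf : measurable_fun setT f by apply/measurable_EFinP; exact: measurable_gauss_excess.
have mg : measurable_fun setT g.
  apply/measurable_EFinP.
  apply: (measurableT_comp (measurable_gauss_excess sigma theta A B (a' + d))).
  exact: (@measurable_funD _ _ R _ id (cst d)).
have f0 y : (0 <= f y)%E by rewrite lee_fin gauss_excess_ge0.
have g0 y : (0 <= g y)%E by rewrite lee_fin gauss_excess_ge0.
have mr : measurable_fun setT (fun y => - d - y).
  exact: (@measurable_funB _ _ R _ (cst (- d)) id).
(* The reflection [y] to [- d - y] preserves the integral, so comparing the paired integrands
   compares twice the integrals. *)
have double (h : R -> \bar R) : measurable_fun setT h -> (forall y, 0 <= h y)%E ->
    (\int[mu]_y (h y + h (- d - y)%R) = 2%:E * \int[mu]_y h y)%E.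
  move=> mh h0; rewrite ge0_integralD//; last exact: (measurableT_comp mh mr).
  by rewrite ge0_integral_reflect// -mule2n mule_natl.
rewrite -[leRHS](ge0_integral_shift d
  (fun y => (gauss_excess sigma theta A B (a' + d) y)%:E)); last 2 first.
- apply/measurable_EFinP; exact: measurable_gauss_excess.
- by move=> y; rewrite lee_fin gauss_excess_ge0.
have two_fin : (2 : R)%:E \is a fin_num by [].
have two_gt0 : (0 < (2 : R)%:E)%E by rewrite lte_fin ltr0n.
suff : (2%:E * \int[mu]_y f y <= 2%:E * \int[mu]_y g y)%E.
  by rewrite (lee_pmul2l two_fin two_gt0).
rewrite -[leLHS](double f mf f0) -[leRHS](double g mg g0).
apply: ge0_le_integral.
- exact: measurableT.
- by move=> y _; exact: adde_ge0.
- by apply: emeasurable_funD => //; exact: (measurableT_comp mf mr).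
- by apply: emeasurable_funD => //; exact: (measurableT_comp mg mr).
- move=> y _; rewrite /f /g -!EFinD lee_fin.
  exact: gauss_excess_pair.
Qed.

End hockey_stick_1d.

(** * Monotonicity of the hockey-stick divergence in dimension n *)

Section hockey_stick.
Context {R : realType}.
Local Notation mu := (@lebesgue_measure R).
Implicit Types (sigma theta A B a b : R) (n : nat).

Lemma iid_gauss_densE n m sigma :
  iid_gauss_dens m sigma = awgn_dens sigma (nseq_tuple n m) :> (n.-tuple R -> R).
Proof.
apply/funext => y; apply: eq_bigr => i _; by rewrite tnth_nseq.
Qed.

Lemma awgn_dens_ge0 n sigma (x y : n.-tuple R) : 0 <= awgn_dens sigma x y.
Proof. by apply: prodr_ge0 => i _; exact: normal_pdf_ge0. Qed.

Lemma measurable_awgn_dens n sigma (x : n.-tuple R) :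
  measurable_fun setT (awgn_dens sigma x).
Proof.
apply: (@measurable_prod _ _ _ _ _ _
  (fun i (y : n.-tuple R) => normal_pdf (tnth x i) sigma (tnth y i))) => i _.
by apply: measurableT_comp (measurable_tnth i); exact: measurable_normal_pdf.
Qed.

Lemma awgn_dens_cons n sigma a (x : n.-tuple R) b (y : n.-tuple R) :
  awgn_dens sigma (cons_tuple a x) (cons_tuple b y) =
  normal_pdf a sigma b * awgn_dens sigma x y.
Proof.
rewrite /awgn_dens big_ord_recl !tnth0; congr (_ * _).
by apply: eq_bigr => i _; rewrite !tnthS.
Qed.

Lemma iid_gauss_dens_cons n m sigma b (y : n.-tuple R) :
  iid_gauss_dens m sigma (cons_tuple b y) =
  normal_pdf m sigma b * iid_gauss_dens m sigma y.
Proof.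
rewrite /iid_gauss_dens big_ord_recl !tnth0; congr (_ * _).
by apply: eq_bigr => i _; rewrite !tnthS.
Qed.

Definition awgn_excess n sigma theta A B (x y : n.-tuple R) : R :=
  Num.max 0 (A * awgn_dens sigma x y - B * iid_gauss_dens 0 theta y).

(** The weights [A] and [B] are kept free because fixing the first output coordinate multiplies them
    by one-dimensional densities, which keeps the inner integral in the same family
    ([hockey_stick_cons]). *)
Definition hockey_stick n sigma theta A B (x : n.-tuple R) : \bar R :=
  lint_n (fun y => (awgn_excess n sigma theta A B x y)%:E).

Lemma awgn_excess_ge0 n sigma theta A B (x y : n.-tuple R) :
  (0 <= (awgn_excess n sigma theta A B x y)%:E)%E.
Proof. by rewrite lee_fin le_max lexx. Qed.

(** Joint measurability in the weights is required since, after peeling off coordinates, the weights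
    are functions of the outer integration variables. *)
Lemma measurable_awgn_excess_joint n sigma theta (x : n.-tuple R) :
  measurable_fun setT (fun z : (R * R) * n.-tuple R =>
    (awgn_excess n sigma theta z.1.1 z.1.2 x z.2)%:E).
Proof.
apply/measurable_EFinP/measurable_maxr => //; apply: measurable_funB.
  apply: measurable_funM => /=.
    exact: (measurableT_comp measurable_fst measurable_fst).
  exact: (measurableT_comp (measurable_awgn_dens n sigma x) measurable_snd).
rewrite iid_gauss_densE; apply: measurable_funM => /=.
  exact: (measurableT_comp measurable_snd measurable_fst).
exact: (measurableT_comp (measurable_awgn_dens n theta _) measurable_snd).
Qed.

Lemma measurable_awgn_excess n sigma theta A B (x : n.-tuple R) :
  measurable_fun setT (fun y => (awgn_excess n sigma theta A B x y)%:E).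
Proof.
exact: (@measurable_fun_pair2 _ _ _ _ _ _ (fun z : (R * R) * n.-tuple R =>
    (awgn_excess n sigma theta z.1.1 z.1.2 x z.2)%:E) (A, B)
  (measurable_awgn_excess_joint n sigma theta x)).
Qed.

Lemma measurable_hockey_stick n sigma theta (x : n.-tuple R) :
  measurable_fun setT (fun z : R * R => hockey_stick n sigma theta z.1 z.2 x).
Proof.
apply: (@measurable_lint_n _ _ _ _ (fun z : (R * R) * n.-tuple R =>
    (awgn_excess n sigma theta z.1.1 z.1.2 x z.2)%:E)).
  exact: measurable_awgn_excess_joint.
by move=> z; exact: awgn_excess_ge0.
Qed.

Lemma hockey_stick_ge0 n sigma theta A B (x : n.-tuple R) :
  (0 <= hockey_stick n sigma theta A B x)%E.
Proof. by apply: lint_n_ge0 => y; exact: awgn_excess_ge0. Qed.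

Lemma hockey_stick_cons n sigma theta A B a (x : n.-tuple R) :
  hockey_stick n.+1 sigma theta A B (cons_tuple a x) =
  (\int[mu]_b hockey_stick n sigma theta
     (A * normal_pdf a sigma b) (B * normal_pdf 0 theta b) x)%E.
Proof.
apply: eq_integral => b _; apply: eq_lint_n => y.
by rewrite /awgn_excess awgn_dens_cons iid_gauss_dens_cons !mulrA.
Qed.

Lemma measurable_hockey_stick_cons n sigma theta A B a (x : n.-tuple R) :
  measurable_fun setT (fun b => hockey_stick n sigma theta
     (A * normal_pdf a sigma b) (B * normal_pdf 0 theta b) x).
Proof.
apply: (measurableT_comp (measurable_hockey_stick n sigma theta x)
  (g := fun b => (A * normal_pdf a sigma b, B * normal_pdf 0 theta b))).
by apply: measurable_fun_pair; apply: measurable_funM => //;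
  exact: measurable_normal_pdf.
Qed.

Lemma normal_pdfM_isometric s a b a' b' y z y' z' : s != 0 ->
  (y - a) ^+ 2 + (z - b) ^+ 2 = (y' - a') ^+ 2 + (z' - b') ^+ 2 ->
  normal_pdf a s y * normal_pdf b s z = normal_pdf a' s y' * normal_pdf b' s z'.
Proof.
move=> s0 E; rewrite !normal_pdf_expR// [LHS]mulrACA [RHS]mulrACA -!expRD.
by rewrite -!opprD -!mulrDl E.
Qed.

(** The output law [N(0, theta^2)] is rotation invariant and the noise is isotropic, so a rotation
    of the first two coordinates may act on the mean alone. *)
Lemma hockey_stick_rotate n sigma theta A B a b r (x : n.-tuple R) :
  sigma != 0 -> theta != 0 -> 0 <= b -> 0 <= r -> r ^+ 2 = a ^+ 2 + b ^+ 2 ->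
  hockey_stick n.+2 sigma theta A B (cons_tuple a (cons_tuple b x)) =
  hockey_stick n.+2 sigma theta A B (cons_tuple 0 (cons_tuple r x)).
Proof.
move=> s0 t0 b0; rewrite le_eqVlt => /predU1P[<-|r0] rab.
  (* When [r] is zero, [a] and [b] both vanish and the two sides coincide. *)
  have /andP[/eqP -> /eqP -> //] : (a == 0) && (b == 0).
  by rewrite -(sqrf_eq0 a) -(sqrf_eq0 b) -paddr_eq0 ?sqr_ge0// -rab expr0n.
pose K a b (z : R * R) := hockey_stick n sigma theta
  (A * (normal_pdf a sigma z.1 * normal_pdf b sigma z.2))
  (B * (normal_pdf 0 theta z.1 * normal_pdf 0 theta z.2)) x.
have KE u v : hockey_stick n.+2 sigma theta A B (cons_tuple u (cons_tuple v x)) =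
    int2 (K u v).
  rewrite hockey_stick_cons; apply: eq_integral => y _.
  rewrite hockey_stick_cons; apply: eq_integral => z _.
  by rewrite /K /= !mulrA.
have mK : measurable_fun setT (K a b).
  apply: (measurableT_comp (measurable_hockey_stick n sigma theta x)
    (g := fun z : R * R => (A * (normal_pdf a sigma z.1 * normal_pdf b sigma z.2),
      B * (normal_pdf 0 theta z.1 * normal_pdf 0 theta z.2)))).
  have mp m s := @measurable_normal_pdf R m s.
  apply: measurable_fun_pair; apply: measurable_funM => //;
    apply: measurable_funM.
  - exact: (measurableT_comp (mp _ _) measurable_fst).
  - exact: (measurableT_comp (mp _ _) measurable_snd).
  - exact: (measurableT_comp (mp _ _) measurable_fst).
  - exact: (measurableT_comp (mp _ _) measurable_snd).
rewrite !KE; have rn0 : r != 0 by rewrite gt_eqF.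
have br : b / r * r = b by rewrite divfK.
have ar : - a / r * r = - a by rewrite divfK.
(* The rotation with cosine [b / r] and sine [- a / r] sends the mean [(0, r)] to [(a, b)]. Since
   [b >= 0], it is not the half-turn. *)
have cs : (b / r) ^+ 2 + (- a / r) ^+ 2 = 1.
  by rewrite !expr_div_n sqrrN -mulrDl addrC -rab divff// expf_neq0.
have c1 : b / r != -1.
  by rewrite gt_eqF// (lt_le_trans _ (divr_ge0 b0 (ltW r0)))// ltrN10.
have K0 z : (0 <= K a b z)%E by exact: hockey_stick_ge0.
rewrite -[LHS](int2_rotation _ _ (K a b) cs c1 mK K0).
congr int2; apply/funext => -[y z] /=; rewrite /K /=.
set c := b / r in br cs *; set s := - a / r in ar cs *.
congr (hockey_stick n sigma theta (A * _) (B * _) x);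
  apply: normal_pdfM_isometric => //.
- have -> : a = - (s * r) by rewrite ar opprK.
  have -> : b = c * r by rewrite br.
  transitivity ((c ^+ 2 + s ^+ 2) * (y ^+ 2 + (z - r) ^+ 2)); first by ring.
  by rewrite cs mul1r subr0.
- transitivity ((c ^+ 2 + s ^+ 2) * (y ^+ 2 + z ^+ 2)); first by ring.
  by rewrite cs mul1r !subr0.
Qed.

Definition sqnorm n (x : n.-tuple R) := \sum_(k < n) tnth x k ^+ 2.

Lemma sqnorm_ge0 n (x : n.-tuple R) : 0 <= sqnorm n x.
Proof. by apply: sumr_ge0 => i _; exact: sqr_ge0. Qed.

Lemma sqnorm_cons n a (x : n.-tuple R) :
  sqnorm n.+1 (cons_tuple a x) = a ^+ 2 + sqnorm n x.
Proof.
rewrite /sqnorm big_ord_recl tnth0; congr (_ + _).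
by apply: eq_bigr => i _; rewrite tnthS.
Qed.

Lemma sqnorm_nseq n a : sqnorm n (nseq_tuple n a) = n%:R * a ^+ 2.
Proof.
rewrite /sqnorm (eq_bigr (fun=> a ^+ 2)) => [|i _].
  by rewrite sumr_const card_ord mulr_natl.
by rewrite tnth_nseq.
Qed.

(** Induction on the dimension. The one-dimensional comparison is the base; beyond it, both means
    are brought to a form with first coordinate 0, and the induction hypothesis compares the
    remaining coordinates under the integral. *)
Lemma le_hockey_stick n sigma theta A B (x x' : n.-tuple R) :
  0 < sigma -> sigma <= theta -> 0 <= A -> 0 <= B ->
  sqnorm n x <= sqnorm n x' ->
  (hockey_stick n sigma theta A B x <= hockey_stick n sigma theta A B x')%E.
Proof.
move=> s0 st; have t0 : 0 < theta by exact: lt_le_trans st.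
have sn0 : sigma != 0 by rewrite gt_eqF.
have tn0 : theta != 0 by rewrite gt_eqF.
elim: n A B x x' => [|[|n] IH] A B x x' A0 B0.
- by rewrite (tuple0 x) (tuple0 x').
- case/tupleP: x => a x; case/tupleP: x' => b x'.
  rewrite !sqnorm_cons (tuple0 x) (tuple0 x') /= lerD2r => ab.
  have E c : hockey_stick 1 sigma theta A B (cons_tuple c [tuple]) =
      (\int[mu]_y (gauss_excess sigma theta A B c y)%:E)%E.
    apply: eq_integral => y _ /=.
    by rewrite /awgn_excess awgn_dens_cons iid_gauss_dens_cons /awgn_dens
      /iid_gauss_dens !big_ord0 !mulr1.
  rewrite !E; apply: le_integral_gauss_excess => //.
  by rewrite -ler_sqr ?nnegrE// !real_normK ?num_real.
have tail a (t t' : n.+1.-tuple R) : sqnorm n.+1 t <= sqnorm n.+1 t' ->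
    (hockey_stick n.+2 sigma theta A B (cons_tuple a t) <=
     hockey_stick n.+2 sigma theta A B (cons_tuple a t'))%E.
  move=> tt'; rewrite !hockey_stick_cons; apply: ge0_le_integral => //.
  - by move=> b _; exact: hockey_stick_ge0.
  - exact: measurable_hockey_stick_cons.
  - exact: measurable_hockey_stick_cons.
  - by move=> b _; apply: IH => //; rewrite mulr_ge0 ?normal_pdf_ge0.
pose e r : n.+1.-tuple R := cons_tuple r (nseq_tuple n 0).
have eE r : sqnorm n.+1 (e r) = r ^+ 2.
  by rewrite sqnorm_cons sqnorm_nseq expr0n/= mulr0 addr0.
have eq_e (a : R) (t : n.+1.-tuple R) :
    hockey_stick n.+2 sigma theta A B (cons_tuple a t) =
    hockey_stick n.+2 sigma theta A B (cons_tuple 0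
      (e (Num.sqrt (sqnorm n.+2 (cons_tuple a t))))).
  (* First the norm of [t] is gathered in its leading coordinate: the two tails have equal norms, so
     [tail] applies both ways. Then the two leading coordinates are rotated. *)
  transitivity (hockey_stick n.+2 sigma theta A B
      (cons_tuple a (e (Num.sqrt (sqnorm n.+1 t))))).
    by apply/eqP; rewrite eq_le; apply/andP; split; apply: tail;
      rewrite eE sqr_sqrtr ?sqnorm_ge0.
  apply: (hockey_stick_rotate _ _ _ _ _ _ _ _ _ sn0 tn0); rewrite ?sqrtr_ge0//.
  by rewrite !sqr_sqrtr ?sqnorm_ge0// sqnorm_cons.
case/tupleP: x => a x; case/tupleP: x' => b x' xx'.
rewrite eq_e (eq_e b); apply: tail; rewrite !eE.
by rewrite !sqr_sqrtr ?sqnorm_ge0.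
Qed.

End hockey_stick.

(** * Expectations of tests and the Neyman-Pearson lemma *)

Section neyman_pearson.
Context {R : realType} (n : nat).
Implicit Types (p q T : n.-tuple R -> R).

Definition density p :=
  [/\ measurable_fun setT p, forall y, 0 <= p y & dexp p (cst 1) = 1%E].

Definition test T := measurable_fun setT T /\ forall y, 0 <= T y <= 1.

(** For a density and a test the integral lies between 0 and 1, so [fine] loses nothing and real
    arithmetic becomes available ([dexp_dexpr]). *)
Definition dexpr p T : R := fine (dexp p T).

Lemma measurable_dexp p T : measurable_fun setT p -> measurable_fun setT T ->
  measurable_fun setT (fun y => (T y * p y)%:E).
Proof. by move=> mp mT; apply/measurable_EFinP; exact: measurable_funM. Qed.

Lemma test_indic (b : n.-tuple R -> bool) : measurable_fun setT b ->
  test (fun y => if b y then 1 else 0).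
Proof.
move=> mb; split; first exact: measurable_fun_ifT.
by move=> y; case: ifP => _; rewrite ?lexx ?ler01.
Qed.

Lemma test_indicC (b : n.-tuple R -> bool) : measurable_fun setT b ->
  test (fun y => if b y then 0 else 1).
Proof.
move=> mb; split; first exact: measurable_fun_ifT.
by move=> y; case: ifP => _; rewrite ?lexx ?ler01.
Qed.

Lemma test_mul_ge0 p T : density p -> test T -> forall y, (0 <= (T y * p y)%:E)%E.
Proof.
by move=> [_ p0 _] [_ T01] y; rewrite lee_fin mulr_ge0//; case/andP: (T01 y).
Qed.

Lemma dexp_dexpr p T : density p -> test T -> dexp p T = (dexpr p T)%:E.
Proof.
move=> dp tT; rewrite fineK// ge0_fin_numE; last first.
  by apply: lint_n_ge0; exact: test_mul_ge0.
have [mp p0 p1] := dp; have [mT T01] := tT.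
apply: (@le_lt_trans _ _ 1%E); last exact: ltry.
rewrite -[leRHS]p1; apply: le_lint_n.
- exact: measurable_dexp.
- exact: measurable_dexp.
- exact: test_mul_ge0.
- by move=> y; rewrite lee_fin ler_wpM2r//; case/andP: (T01 y).
Qed.

Lemma dexpr_ge0 p T : density p -> test T -> 0 <= dexpr p T.
Proof. by move=> dp tT; apply/fine_ge0/lint_n_ge0; exact: test_mul_ge0. Qed.

Lemma le_dexpr p T T' : density p -> test T -> test T' ->
  (forall y, T y <= T' y) -> dexpr p T <= dexpr p T'.
Proof.
move=> dp tT tT' TT'; rewrite -lee_fin -!dexp_dexpr//.
apply: le_lint_n.
- by apply: measurable_dexp; [case: dp|case: tT].
- by apply: measurable_dexp; [case: dp|case: tT'].
- exact: test_mul_ge0.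
- by move=> y; rewrite lee_fin ler_wpM2r//; case: dp.
Qed.

Lemma dexprD p T T' : density p -> test T -> test T' ->
  test (fun y => T y + T' y) ->
  dexpr p (fun y => T y + T' y) = dexpr p T + dexpr p T'.
Proof.
move=> dp tT tT' tTT'; apply: EFin_inj; rewrite EFinD -!dexp_dexpr//.
rewrite -[RHS]lint_nD.
- by apply: eq_lint_n => y; rewrite mulrDl EFinD.
- by apply: measurable_dexp; [case: dp|case: tT].
- by apply: measurable_dexp; [case: dp|case: tT'].
- exact: test_mul_ge0.
- exact: test_mul_ge0.
Qed.

Lemma dexpr1 p : density p -> dexpr p (cst 1) = 1.
Proof. by move=> [_ _ p1]; rewrite /dexpr p1. Qed.

Lemma test1 : test (cst 1).
Proof. by split=> // y; rewrite ler01 lexx. Qed.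

Lemma dexpr_indicC p (b : n.-tuple R -> bool) : density p ->
  measurable_fun setT b ->
  dexpr p (fun y => if b y then 0 else 1) =
  1 - dexpr p (fun y => if b y then 1 else 0).
Proof.
move=> dp mb.
have := dexprD p _ _ dp (test_indicC b mb) (test_indic b mb).
rewrite (_ : (fun y => _ + _) = cst 1); last first.
  by apply/funext => y /=; case: ifP; rewrite ?add0r ?addr0.
by move=> /(_ test1); rewrite dexpr1// => H; lra.
Qed.

Lemma le_dexprZ p q T T' (k : R) : density p -> density q -> test T -> test T' ->
  0 <= k -> (forall y, k * (T y * q y) <= T' y * p y) ->
  k * dexpr q T <= dexpr p T'.
Proof.
move=> dp dq tT tT' k0 le_TT'; rewrite -lee_fin EFinM -!dexp_dexpr//.
rewrite -lint_nZl//; [|by apply: measurable_dexp; [case: dq|case: tT]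
  |exact: test_mul_ge0].
apply: le_lint_n.
- apply/measurable_EFinP; apply: measurable_funM => //.
  by apply: measurable_funM; [case: tT|case: dq].
- by apply: measurable_dexp; [case: dp|case: tT'].
- by move=> y; apply: mule_ge0 => //; exact: test_mul_ge0.
- by move=> y; rewrite -EFinM lee_fin.
Qed.

Lemma dexprZ p T (k : R) : density p -> test T -> 0 <= k ->
  dexpr p (fun y => k * T y) = k * dexpr p T.
Proof.
move=> dp tT k0; rewrite /dexpr -[k in RHS]/(fine k%:E) -fineM//; last first.
  by rewrite dexp_dexpr.
congr fine; rewrite -lint_nZl//.
- by apply: eq_lint_n => y; rewrite -mulrA EFinM.
- by apply: measurable_dexp; [case: dp|case: tT].
- exact: test_mul_ge0.
Qed.

(** Monotone convergence: [T] lies below the pointwise limit of the nondecreasing tests [f k]. It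
    provides the one-sided limits in the threshold for [neyman_pearson]. *)
Lemma dexpr_sup p (f : nat -> n.-tuple R -> R) T (b : R) : density p ->
  (forall k, test (f k)) -> test T ->
  (forall y, {homo f ^~ y : k l / (k <= l)%N >-> k <= l}) ->
  (forall y, exists k, T y <= f k y) -> (forall k, dexpr p (f k) <= b) ->
  dexpr p T <= b.
Proof.
move=> dp tf tT ndf Tf fb; have [mp p0 _] := dp.
pose F k y := (f k y * p y)%:E.
have mF k : measurable_fun setT (F k) by apply: measurable_dexp => //; case: (tf k).
have F0 k y : (0 <= F k y)%E by exact: test_mul_ge0.
have ndF y : {homo F ^~ y : k l / (k <= l)%N >-> (k <= l)%E}.
  by move=> k l kl; rewrite lee_fin ler_wpM2r// ndf.
have ndI : {homo (fun k => lint_n (F k)) : k l / (k <= l)%N >-> (k <= l)%E}.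
  by move=> k l kl; apply: le_lint_n => // y; exact: ndF.
rewrite -lee_fin -dexp_dexpr//; apply: (@le_trans _ _ (limn (fun k => lint_n (F k)))).
  rewrite -(lint_n_monotone_convergence _ F)//; apply: le_lint_n.
  - by apply: measurable_dexp => //; case: tT.
  - apply: (@emeasurable_fun_cvg _ _ _ _ F) => // y _.
    exact: ereal_nondecreasing_is_cvgn.
  - exact: test_mul_ge0.
  - move=> y; have [k Tk] := Tf y.
    rewrite (cvg_lim _ (ereal_nondecreasing_cvgn (ndF y)))//.
    apply: (@le_trans _ _ (F k y)); first by rewrite lee_fin ler_wpM2r.
    by apply: ereal_sup_ubound; exists k.
apply: lime_le; first exact: ereal_nondecreasing_is_cvgn.
by apply: nearW => k; rewrite -[leLHS]/(dexp p (f k)) dexp_dexpr// lee_fin.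
Qed.

Lemma exists_mul_invS_lt (c e : R) : 0 <= c -> 0 < e ->
  exists k : nat, c * k.+1%:R^-1 < e.
Proof.
move=> c0 e0; exists (Num.bound (c / e)).
rewrite ltr_pdivrMr ?ltr0n// mulrC -ltr_pdivrMr//.
apply: lt_trans (archi_boundP _) _; first by rewrite divr_ge0// ltW.
by rewrite ltr_nat.
Qed.

Lemma invS_le (k l : nat) : (k <= l)%N -> l.+1%:R^-1 <= k.+1%:R^-1 :> R.
Proof. by move=> kl; rewrite lef_pV2 ?posrE ?ltr0n// ler_nat ltnS. Qed.

(** The threshold [lam] is the infimum of those [l] for which the event [p > l q] has
    [q]-probability at most [beta]. The test accepts above the threshold, rejects below it, and on
    ties accepts with a probability [gam] chosen to reach level [beta] exactly. *)
Lemma neyman_pearson p q (beta : R) : density p -> density q ->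
  0 < beta -> beta <= 1 ->
  exists lam T, [/\ 0 <= lam, test T, dexpr q T = beta &
    forall y, T y * (p y - lam * q y) = Num.max 0 (p y - lam * q y)].
Proof.
move=> dp dq b0 b1; have [mp p0 _] := dp; have [mq q0 _] := dq.
have mlq lam : measurable_fun setT (fun y => lam * q y).
  exact: (@measurable_funM _ _ R _ (cst lam)).
have mgt lam : measurable_fun setT (fun y => lam * q y < p y).
  exact: measurable_fun_ltr.
have mlt lam : measurable_fun setT (fun y => p y < lam * q y).
  exact: measurable_fun_ltr.
pose above lam y : R := if lam * q y < p y then 1 else 0.
pose below lam y : R := if p y < lam * q y then 1 else 0.
have tabove lam : test (above lam) by exact: test_indic.
have tbelow lam : test (below lam) by exact: test_indic.
have above_le l m : l <= m -> dexpr q (above m) <= dexpr q (above l).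
  move=> lm; apply: le_dexpr => // y; rewrite /above.
  case: ifP => [mqp|_]; last by case: ifP => _; rewrite ?ler01.
  by rewrite (le_lt_trans _ mqp)// ler_wpM2r.
pose S := [set l : R | 0 <= l /\ dexpr q (above l) <= beta].
have S0 : S !=set0.
  (* Markov's inequality: where [p > q / beta], the density [q] is at most [beta * p], and [p] has
     total mass 1. *)
  exists beta^-1; split; first by rewrite invr_ge0 ltW.
  rewrite -(ler_pM2l (_ : 0 < beta^-1)) ?invr_gt0// mulVf ?gt_eqF//.
  rewrite -(dexpr1 p dp); apply: le_dexprZ => //; first exact: test1.
    by rewrite invr_ge0 ltW.
  move=> y; rewrite /above; case: ifP => [/ltW|_]; first by rewrite !mul1r.
  by rewrite mul0r mulr0 mul1r.
have lbS : has_lbound S by exists 0 => l [].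
have infS : has_inf S by split.
pose lam := inf S.
have lam0 : 0 <= lam by apply: lb_le_inf => // l [].
(* The infimum is attained: the event [p > lam q] is the increasing union of the events with
   threshold [lam + 1/(k+1)], each above some member of [S]. *)
have Q_above : dexpr q (above lam) <= beta.
  apply: (dexpr_sup q (fun k => above (lam + k.+1%:R^-1))) => //.
  - move=> y k l kl; rewrite /above; case: ifP => [kqp|_]; last first.
      by case: ifP => _; rewrite ?ler01.
    by rewrite (le_lt_trans _ kqp)// ler_wpM2r// lerD2l invS_le.
  - move=> y; rewrite {1}/above; case: ifP => [lqp|_]; last first.
      by exists 0; case: (tabove (lam + 1^-1)) => _ /(_ y)/andP[].
    have [k kq] := exists_mul_invS_lt (q y) (p y - lam * q y) (q0 y)
      (eq_ind_r is_true lqp (subr_gt0 _ _)).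
    by exists k; rewrite /above ifT// mulrDl -ltrBrDl mulrC.
  - move=> k; have [|l [_ lb] llam] := @inf_adherent _ S k.+1%:R^-1 _ infS.
      by rewrite invr_gt0 ltr0n.
    by apply: le_trans lb; apply: above_le; exact: ltW.
(* For [lam > 0], the thresholds [lam * (1 - 1/(k+1))] lie strictly below the infimum, so their
   events have probability above [beta]; the complements increase and cover [p < lam q]. The
   multiplicative form keeps the thresholds nonnegative, as membership in [S] requires. For
   [lam = 0] the event is empty. *)
have Q_below : dexpr q (below lam) <= 1 - beta.
  have [lam_gt0|lam_le0] := ltP 0 lam; last first.
    have -> : below lam = fun y => 0 * cst 1 y.
      apply/funext => y; rewrite /below mul0r ifF//; apply/negbTE.
      by rewrite -leNgt (le_trans _ (p0 y))// mulr_le0_ge0.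
    by rewrite dexprZ//; [rewrite mul0r subr_ge0|exact: test1].
  apply: (dexpr_sup q (fun k y =>
    if lam * (1 - k.+1%:R^-1) * q y < p y then 0 else 1)) => //.
  - by move=> k; exact: test_indicC.
  - move=> y k l kl; case: ifP => [_|/negbT]; first by case: ifP => _; rewrite ?ler01.
    rewrite -leNgt => pk; rewrite ifF//; apply/negbTE; rewrite -leNgt.
    apply: le_trans pk _; rewrite ler_wpM2r// ler_wpM2l// lerD2l lerN2.
    exact: invS_le.
  - move=> y; rewrite /below; case: ifP => [plq|_]; last first.
      by exists 0; case: ifP => _; rewrite ?ler01.
    have [k kq] := exists_mul_invS_lt (lam * q y) (lam * q y - p y)
      (mulr_ge0 lam0 (q0 y)) (eq_ind_r is_true plq (subr_gt0 _ _)).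
    exists k; rewrite ifF//; apply/negbTE; rewrite -leNgt.
    rewrite (_ : _ * q y = lam * q y - lam * q y * k.+1%:R^-1); last by ring.
    by rewrite lerBrDr -lerBrDl ltW.
  - move=> k; rewrite dexpr_indicC// lerD2l lerN2.
    apply: ltW; rewrite ltNge; apply/negP => kb.
    have : lam <= lam * (1 - k.+1%:R^-1).
      apply: ge_inf => //; split => //.
      by rewrite mulr_ge0// subr_ge0 invf_le1 ?ltr0n// ler1n.
    by rewrite ler_pMr// lerBrDr gerDl leNgt invr_gt0 ltr0n.
pose tie y : R := if (p y <= lam * q y) && (lam * q y <= p y) then 1 else 0.
have ttie : test tie.
  by apply: test_indic; apply: measurable_and; exact: measurable_fun_ler.
pose ge y : R := if p y < lam * q y then 0 else 1.
have tge : test ge by exact: test_indicC.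
have Q_ge : dexpr q ge = dexpr q (above lam) + dexpr q tie.
  have E : ge = fun y => above lam y + tie y.
    apply/funext => y; rewrite /ge /above /tie.
    by case: ltgtP; rewrite ?addr0 ?add0r.
  by rewrite E dexprD// -E.
have Q_ge_beta : beta <= dexpr q (above lam) + dexpr q tie.
  by rewrite -Q_ge dexpr_indicC// lerBrDr -lerBrDl.
(* The level [beta] lies between the masses of [p > lam q] and [p >= lam q], and [gam] interpolates.
   If ties have [q]-mass zero, both masses equal [beta] and [gam] is set to 0. *)
have [gam [gam0 gam1 gamE]] : exists gam, [/\ 0 <= gam, gam <= 1 &
    dexpr q (above lam) + gam * dexpr q tie = beta].
  have [tie0|tie0] := eqVneq (dexpr q tie) 0.
    exists 0; split => //; rewrite mul0r addr0; apply/eqP.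
    by rewrite eq_le Q_above/= (le_trans Q_ge_beta)// tie0 addr0.
  have tie_gt0 : 0 < dexpr q tie by rewrite lt_def tie0 dexpr_ge0.
  exists ((beta - dexpr q (above lam)) / dexpr q tie); split.
  - by rewrite divr_ge0 ?subr_ge0// ltW.
  - by rewrite ler_pdivrMr// mul1r lerBlDl.
  - by rewrite divfK// addrC subrK.
pose T y := above lam y + gam * tie y.
have tgtie : test (fun y => gam * tie y).
  case: ttie => mtie tie01; split; first exact: (@measurable_funM _ _ R _ (cst gam)).
  by move=> y; rewrite /tie; case: ifP => _; rewrite ?mulr1 ?mulr0 ?gam0 ?gam1 ?lexx ?ler01.
have tT : test T.
  split; first by apply: measurable_funD; [case: (tabove lam)|case: tgtie].
  move=> y; rewrite /T /above /tie; case: ltgtP => _ /=.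
  - by rewrite mulr0 addr0 ler01 lexx.
  - by rewrite mulr0 addr0 ler01 lexx.
  - by rewrite mulr1 add0r gam0.
exists lam, T; split => //.
  by rewrite dexprD// dexprZ.
move=> y; rewrite /T /above /tie; case: ltgtP => [lqp|plq|E] /=.
- by rewrite mulr0 addr0 mul1r max_r// subr_ge0 ltW.
- by rewrite mulr0 addr0 mul0r max_l// subr_le0 ltW.
- by rewrite E subrr mulr0 maxxx.
Qed.

End neyman_pearson.

(** * Decoding regions and the change of measure to the auxiliary output law *)

Section meta_converse.
Context {R : realType}.
Implicit Types (sigma theta : R) (n M : nat).

Lemma awgn_density n sigma (x : n.-tuple R) : density n (awgn_dens sigma x).
Proof.
split; [exact: measurable_awgn_dens|exact: awgn_dens_ge0|].
rewrite /dexp; under eq_fun do rewrite mul1r.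
elim: n x => [|n IH] x; first by rewrite /= /awgn_dens big_ord0.
case/tupleP: x => a x /=; rewrite -[RHS](integral_normal_pdf a sigma).
apply: eq_integral => b _.
under eq_fun do rewrite awgn_dens_cons EFinM.
rewrite lint_nZl ?normal_pdf_ge0//.
- by rewrite IH mule1.
- by apply/measurable_EFinP; exact: measurable_awgn_dens.
- by move=> y; rewrite lee_fin awgn_dens_ge0.
Qed.

Lemma gauss_density n m sigma : density n (iid_gauss_dens m sigma).
Proof. by rewrite iid_gauss_densE; exact: awgn_density. Qed.

Lemma measurable_big_and d (T : measurableType d) (I : Type) (r : seq I)
    (b : I -> T -> bool) : (forall i, measurable_fun setT (b i)) ->
  measurable_fun setT (fun y => \big[andb/true]_(i <- r) b i y).
Proof.
move=> mb; elim: r => [|i r IH].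
  by under eq_fun do rewrite big_nil; exact: measurable_cst.
by under eq_fun do rewrite big_cons; exact: measurable_and.
Qed.

Lemma measurable_ml_decodes n M sigma (c : 'I_M -> n.-tuple R) (j : 'I_M) :
  measurable_fun setT (ml_decodes sigma c j).
Proof.
have -> : ml_decodes sigma c j = fun y => \big[andb/true]_(i < M)
    (if (i < j)%N then awgn_dens sigma (c i) y < awgn_dens sigma (c j) y
     else awgn_dens sigma (c i) y <= awgn_dens sigma (c j) y).
  by apply/funext => y; rewrite big_andE.
apply: measurable_big_and => i; case: (i < j)%N.
  by apply: measurable_fun_ltr; exact: measurable_awgn_dens.
by apply: measurable_fun_ler; exact: measurable_awgn_dens.
Qed.

(** The strict inequality demanded against smaller indices contradicts the weak one demanded against
    larger indices, so the decoding regions are disjoint. *)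
Lemma ml_decodes_inj n M sigma (c : 'I_M -> n.-tuple R) (i j : 'I_M) y :
  ml_decodes sigma c i y -> ml_decodes sigma c j y -> i = j.
Proof.
move=> /forallP /(_ j) di /forallP /(_ i) dj; apply/val_inj/eqP.
case: (ltngtP i j) di dj => // _; first by move=> le /lt_geF; rewrite le.
by move=> /lt_geF ->.
Qed.

Lemma sum_ml_decodes_le1 n M sigma (c : 'I_M -> n.-tuple R) y :
  \sum_(j < M) (if ml_decodes sigma c j y then 1 else 0 : R) <= 1.
Proof.
have [/existsP[j dj]|/existsPn nd] := boolP [exists j, ml_decodes sigma c j y].
  rewrite (bigD1 j)//= dj big1 ?addr0// => i ij; rewrite ifF//; apply/negbTE.
  by apply: contra ij => di; rewrite (ml_decodes_inj _ _ _ _ _ _ _ di dj).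
by rewrite big1 ?ler01// => j _; rewrite (negbTE (nd j)).
Qed.

Lemma sum_dexpr_ml_decodes_le1 n M sigma (c : 'I_M -> n.-tuple R) q :
  density n q ->
  \sum_(j < M) dexpr n q (fun y => if ml_decodes sigma c j y then 1 else 0) <= 1.
Proof.
move=> dq; pose D j y : R := if ml_decodes sigma c j y then 1 else 0.
have tD j : test n (D j) by apply: test_indic; exact: measurable_ml_decodes.
have [mq q0 q1] := dq.
rewrite -lee_fin -sumEFin -[leRHS]q1.
under eq_bigr do rewrite -(dexp_dexpr _ _ _ dq (tD _)).
rewrite -lint_n_sum; last 2 first.
- by move=> j; apply: measurable_dexp => //; case: (tD j).
- by move=> j; exact: test_mul_ge0.
apply: le_lint_n.
- by apply: emeasurable_sum => j; apply: measurable_dexp => //; case: (tD j).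
- exact: measurable_dexp.
- by move=> y; apply: sume_ge0 => j _; exact: test_mul_ge0.
- move=> y; rewrite sumEFin lee_fin -mulr_suml ler_wpM2r//.
  exact: sum_ml_decodes_le1.
Qed.

(** Gathers the two terms in a single integral, so that the next two lemmas reduce to pointwise
    statements. *)
Lemma hockey_stickD n sigma theta lam (x : n.-tuple R) T : 0 <= lam -> test n T ->
  (hockey_stick n sigma theta 1 lam x +
     lam%:E * dexp (iid_gauss_dens 0 theta) T)%E =
  lint_n (fun y => (awgn_excess n sigma theta 1 lam x y +
                    T y * (lam * iid_gauss_dens 0 theta y))%:E).
Proof.
move=> lam0 tT; have dq := gauss_density n 0 theta; have [mq q0 _] := dq.
have mTq : measurable_fun setT (fun y => (T y * iid_gauss_dens 0 theta y)%:E).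
  by apply: measurable_dexp => //; case: tT.
rewrite -lint_nZl//; [|exact: test_mul_ge0].
rewrite -lint_nD.
- by apply: eq_lint_n => y; rewrite -EFinM -EFinD mulrCA.
- exact: measurable_awgn_excess.
- exact: measurable_funeM.
- by move=> y; exact: awgn_excess_ge0.
- by move=> y; apply: mule_ge0 => //; exact: test_mul_ge0.
Qed.

(** Pointwise, [T * u <= max 0 u] for [0 <= T <= 1], with [u] the difference of the densities
    [w - lam q]. *)
Lemma le_dexp_hockey_stick n sigma theta lam (x : n.-tuple R) T : 0 <= lam ->
  test n T ->
  (dexp (awgn_dens sigma x) T <= hockey_stick n sigma theta 1 lam x +
     lam%:E * dexp (iid_gauss_dens 0 theta) T)%E.
Proof.
move=> lam0 tT; have dp := awgn_density n sigma x; have dq := gauss_density n 0 theta.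
have [mp p0 _] := dp; have [mq q0 _] := dq; have [mT T01] := tT.
rewrite hockey_stickD//; apply: le_lint_n.
- exact: measurable_dexp.
- apply/measurable_EFinP; apply: measurable_funD.
    by apply/measurable_EFinP; exact: measurable_awgn_excess.
  apply: measurable_funM => //; exact: (@measurable_funM _ _ R _ (cst lam)).
- exact: test_mul_ge0.
- move=> y; rewrite lee_fin /awgn_excess mul1r -lerBlDr -mulrBr.
  have /andP[T0 T1] := T01 y.
  have [u0|u0] := leP 0 (awgn_dens sigma x y - lam * iid_gauss_dens 0 theta y).
    by rewrite -[leRHS]mul1r ler_wpM2r.
  by rewrite mulr_ge0_le0// ltW.
Qed.

Lemma dexp_hockey_stick n sigma theta lam (x : n.-tuple R) T : 0 <= lam ->
  test n T ->
  (forall y, T y * (awgn_dens sigma x y - lam * iid_gauss_dens 0 theta y) =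
     Num.max 0 (awgn_dens sigma x y - lam * iid_gauss_dens 0 theta y)) ->
  dexp (awgn_dens sigma x) T = (hockey_stick n sigma theta 1 lam x +
     lam%:E * dexp (iid_gauss_dens 0 theta) T)%E.
Proof.
move=> lam0 tT TE; rewrite hockey_stickD//; apply: eq_lint_n => y.
by rewrite /awgn_excess mul1r -TE -mulrDr subrK.
Qed.

End meta_converse.

(** * Averaging over the codewords *)

Theorem theorem3 (R : realType) (sigma theta : R) (n M : nat) (Ups : R) :
  0 < sigma -> sigma <= theta -> (1 <= n)%N -> (1 <= M)%N -> 0 < Ups ->
  (alpha_beta (M%:R)^-1 (@iid_gauss_dens R n (Num.sqrt Ups) sigma)
                        (@iid_gauss_dens R n 0 theta)
   <= eps_star_m sigma n M Ups)%E.
Proof.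
move=> s0 st _ M0 U0; apply: le_ereal_inf_tmp => _ [c cU <-].
have Mr0 : 0 < M%:R :> R by rewrite ltr0n.
(* The constant input [x0] has energy exactly [n * Ups], the largest allowed, and its output law is
   the first argument of [alpha_beta]. *)
pose x0 := nseq_tuple n (Num.sqrt Ups); pose q := @iid_gauss_dens R n 0 theta.
have dq : density n q := gauss_density n 0 theta.
have dp := awgn_density n sigma x0.
have [||lam [T [lam0 tT QT TE]]] := neyman_pearson n _ _ (M%:R^-1) dp dq.
- by rewrite invr_gt0.
- by rewrite invf_le1// ler1n.
have PT := dexp_hockey_stick n sigma theta lam x0 T lam0 tT TE.
rewrite !dexp_dexpr// QT -EFinM in PT.
(* [PT] equates a real number with the divergence plus a real number, so the divergence is
   finite. *)
have [H HE] : exists H : R, hockey_stick n sigma theta 1 lam x0 = H%:E.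
  have := hockey_stick_ge0 n sigma theta 1 lam x0; move: PT.
  by case: hockey_stick => // r _ _; exists r.
rewrite HE -EFinD in PT; case: PT => PT.
pose D j y : R := if ml_decodes sigma c j y then 1 else 0.
have mD j := measurable_ml_decodes n M sigma c j.
have tD j : test n (D j) by exact: test_indic.
have W j := awgn_density n sigma (c j).
have WD j : dexpr n (awgn_dens sigma (c j)) (D j) <= H + lam * dexpr n q (D j).
  rewrite -lee_fin EFinD EFinM -!dexp_dexpr// -HE.
  apply: le_trans (le_dexp_hockey_stick n sigma theta lam (c j) (D j) lam0 (tD j)) _.
  (* The energy constraint on [c j] enters here, through monotonicity in the norm. *)
  apply: leeD2r; apply: le_hockey_stick => //.
  by rewrite sqnorm_nseq sqr_sqrtr ?(ltW U0)//; exact: cU.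
have PeE : Pe sigma c = (M%:R^-1 *
    \sum_(j < M) (1 - dexpr n (awgn_dens sigma (c j)) (D j)))%:E.
  rewrite EFinM -sumEFin; congr (_ * _)%E; apply: eq_bigr => j _.
  by rewrite dexp_dexpr//; [rewrite dexpr_indicC|exact: test_indicC].
apply: (@le_trans _ _ (1 - (dexpr n (awgn_dens sigma x0) T)%:E)%E).
  (* The Neyman-Pearson test has level exactly [1/M], hence is admissible in the infimum. *)
  apply: ereal_inf_lbound; exists T.
    by split; [case: tT|case: tT|rewrite dexp_dexpr// QT].
  by rewrite iid_gauss_densE dexp_dexpr.
rewrite PeE -EFinB lee_fin PT [leRHS]mulrC ler_pdivlMr//.
have sumQ := sum_dexpr_ml_decodes_le1 n M sigma c q dq.
(* Disjointness turns the [M] terms in [lam] into a single [lam]; after division by [M] this matches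
   the value [H + lam / M] attained by [T]. *)
have sumW : \sum_(j < M) dexpr n (awgn_dens sigma (c j)) (D j) <= M%:R * H + lam.
  apply: le_trans (ler_sum _ (fun j _ => WD j)) _.
  rewrite big_split/= sumr_const card_ord -[H *+ M]mulr_natl lerD2l -mulr_sumr.
  by rewrite -[leRHS]mulr1 ler_wpM2l.
rewrite sumrB sumr_const card_ord lerBrDl.
apply: le_trans (lerD sumW (lexx _)) _.
rewrite mulrBl mulrDl mul1r -mulrA mulVf ?gt_eqF// mulr1.
by rewrite [H * _]mulrC addrC subrK.
Qed.
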